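(* Let $n\ge 2$ and let $A=(a_{ij})$ be a real $n\times n$ matrix (entries may be negative) such that: (a) $A\mathbf 1=\mathbf 1$, and every (complex) eigenvalue of $A$ has modulus at most $1$; (b) there exists a vector $\pi=(\pi_1,\ldots,\pi_n)$ with all entries positive such that $\pi^TA=\pi^T$; (c) $\pi_i a_{ij}=\pi_j a_{ji}$ for all $i,j$. Let $$S=\Big\{x\in\mathbb R^n\ \Big|\ \sum_{i=1}^n\pi_i x_i=0,\ \sum_{i=1}^n\pi_i x_i^2=1\Big\}.$$ Then all eigenvalues of $A$ are real and, listing them with multiplicity in decreasing order as $1=\lambda_1\ge\lambda_2\ge\cdots\ge\lambda_n$, $$\lambda_2=1-\frac12\min_{x\in S}\sum_{i=1}^n\sum_{j=1}^n\pi_i a_{ij}(x_i-x_j)^2 .$$ In particular, for every nonzero vector $y\in\mathbb R^n$ with $\sum_{i=1}^n\pi_i y_i=0$, $$\lambda_2\ \ge\ 1-\frac{\sum_{i=1}^n\sum_{j=1}^n\pi_i a_{ij}(y_i-y_j)^2}{2\sum_{i=1}^n\pi_i y_i^2}.$$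
   Context: $\mathbf 1$ denotes the vector in $\mathbb R^n$ with all components equal to $1$. *)

(* Defs.v *)
From mathcomp Require Import all_boot all_order all_algebra.
From mathcomp Require Import complex.
From mathcomp Require Import classical_sets reals.

Set Implicit Arguments.
Unset Strict Implicit.
Unset Printing Implicit Defensive.

Import Order.TTheory GRing.Theory Num.Theory.
Local Open Scope classical_set_scope.
Local Open Scope ring_scope.

(* Viewing A over R[i] gives access to its complex eigenvalues. *)
Definition complexify (R : realType) (n : nat) (A : 'M[R]_n) : 'M[R[i]]_n :=
  map_mx (real_complex R) A.

(* Eigenvalues are repeated by algebraic multiplicity, over R[i]. The equation
   and the ordering determine s uniquely. *)
Definition sorted_spectrum (R : realType) (n : nat) (A : 'M[R]_n)
    (s : n.-tuple R) : Prop :=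
  char_poly (complexify A) = \prod_(l <- s) ('X - (real_complex R l)%:P) /\
  sorted (fun x y : R => y <= x) s.

Definition is_minimum (R : realType) (E : set R) (m : R) : Prop :=
  E m /\ lbound E m.

Definition constraint_set (R : realType) (n : nat) (pi : 'cV[R]_n) :
    set 'cV[R]_n :=
  [set x | \sum_i pi i 0 * x i 0 = 0 /\ \sum_i pi i 0 * x i 0 ^+ 2 = 1].

Definition dirichlet_sum (R : realType) (n : nat) (A : 'M[R]_n)
    (pi x : 'cV[R]_n) : R :=
  \sum_i \sum_j pi i 0 * A i j * (x i 0 - x j 0) ^+ 2.

(* Main.v *)
Require Import Defs.
From mathcomp Require Import all_boot all_order all_algebra.
From mathcomp Require Import complex.
From mathcomp Require Import classical_sets reals.
From mathcomp Require Import sesquilinear spectral ring.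

Set Implicit Arguments.
Unset Strict Implicit.
Unset Printing Implicit Defensive.

Import Order.TTheory GRing.Theory Num.Theory.
Local Open Scope classical_set_scope.
Local Open Scope ring_scope.

(** Reversibility says that [A] is self-adjoint for the inner product
    [<x, y> = \sum_i pi_i x_i y_i]. With [S = diag (sqrt pi_i)], the matrix
    [S A S^-1] is therefore symmetric, and since [A] fixes the constant vector
    [1], it fixes the unit vector [u] proportional to [S 1]. A reflection [H]
    exchanging [u] and the first basis vector [e] turns it into a symmetric
    matrix that fixes [e], that is, into a block matrix [diag (1, B)] with [B]
    symmetric. So [M = H S] is at once a change of basis from [A] to
    [diag (1, B)], an isometry from [<., .>] to the standard inner product, and
    a map sending the vectors with [\sum_i pi_i x_i = 0] onto those whose
    first coordinate vanishes; this is [reversible_reduction].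

    The spectral theorem for [B] ([symmetric_spectrum]) gives that its
    characteristic polynomial splits over the reals, that its largest root [b]
    bounds the Rayleigh quotient of [B], and that a unit real eigenvector
    attains the bound. Hence the spectrum of [A] is [1] followed by that of
    [B], and it is in decreasing order because no eigenvalue of [A] exceeds
    [1] in modulus; in particular [lambda_2 = b].

    Finally, because the rows of [A] sum to [1] and [pi] is stationary,
    expanding the squares gives [dirichlet_sum A pi x = 2 (<x, x> - <x, A x>)]
    ([dirichlet_sumE]). For a centred [x] with [M x = (0, y)] the right-hand
    side is [2 (y^T y - y^T B y) >= 2 (1 - b) <x, x>], with equality for the
    [x] that corresponds to the top eigenvector of [B]. Both the minimum over
    the constraint set and the bound for arbitrary centred vectors follow. *)

(** * Characteristic polynomials *)

Lemma char_poly_conj (F : fieldType) (n : nat) (P D : 'M[F]_n) :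
  P \in unitmx -> char_poly (invmx P *m D *m P) = char_poly D.
Proof.
move=> Pu; pose Q := map_mx polyC P; pose Q' := map_mx polyC (invmx P).
have Q'Q : Q' *m Q = 1%:M by rewrite -map_mxM mulVmx // map_mx1.
have cE : char_poly_mx (invmx P *m D *m P) = Q' *m char_poly_mx D *m Q.
  rewrite /char_poly_mx mulmxBr mulmxBl !map_mxM; congr (_ - _).
  by rewrite scalar_mxC -mulmxA Q'Q mulmx1.
by rewrite /char_poly cE !det_mulmx mulrAC -det_mulmx Q'Q det1 mul1r.
Qed.

Lemma char_poly_block_diag (F : comNzRingType) (n1 n2 : nat)
    (A : 'M[F]_n1) (B : 'M[F]_n2) :
  char_poly (block_mx A 0 0 B) = char_poly A * char_poly B.
Proof. by rewrite /char_poly char_block_diag_mx det_ublock. Qed.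

Lemma char_poly_mx11 (F : comNzRingType) (a : F) :
  char_poly (a%:M : 'M[F]_1) = 'X - a%:P.
Proof. by rewrite /char_poly det_mx11 !mxE. Qed.

(** A split characteristic polynomial over [R[i]] with real roots leaves no
    room for other complex eigenvalues. *)
Lemma split_eigenvalue (R : realType) (n : nat) (A : 'M[R]_n) (s : seq R)
    (z : R[i]) :
  char_poly (complexify A) = \prod_(l <- s) ('X - (real_complex R l)%:P) ->
  eigenvalue (complexify A) z = (z \in map (real_complex R) s).
Proof.
move=> cA; rewrite eigenvalue_root_char cA.
rewrite -(big_map (real_complex R) xpredT (fun l => 'X - l%:P)).
exact: root_prod_XsubC.
Qed.

Lemma eigenvalue_complexify (R : realType) (n : nat) (A : 'M[R]_n) (r : R) :
  eigenvalue (complexify A) (real_complex R r) = eigenvalue A r.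
Proof.
by rewrite !eigenvalue_root_char -map_char_poly fmorph_root.
Qed.

(** * Squared Euclidean norm and reflections *)

Definition normsq (R : realType) (n : nat) (x : 'cV[R]_n) : R :=
  (x^T *m x) 0 0.

Lemma normsqE (R : realType) (n : nat) (x : 'cV[R]_n) :
  normsq x = \sum_i x i 0 ^+ 2.
Proof. by rewrite /normsq !mxE; apply: eq_bigr => i _; rewrite mxE expr2. Qed.

Lemma normsq_eq0 (R : realType) (n : nat) (x : 'cV[R]_n) :
  (normsq x == 0) = (x == 0).
Proof.
rewrite normsqE psumr_eq0; last by move=> i _; apply: sqr_ge0.
apply/allP/eqP => [h|-> i _]; last by rewrite mxE expr0n eqxx.
apply/colP => i; rewrite mxE; apply/eqP.
by have := h i (mem_index_enum i); rewrite /= sqrf_eq0.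
Qed.

Lemma normsq_gt0 (R : realType) (n : nat) (x : 'cV[R]_n) :
  (0 < normsq x) = (x != 0).
Proof.
by rewrite lt_neqAle eq_sym normsq_eq0 normsqE sumr_ge0 ?andbT // => i _;
  apply: sqr_ge0.
Qed.

Lemma normsqZ (R : realType) (n : nat) (c : R) (x : 'cV[R]_n) :
  normsq (c *: x) = c ^+ 2 * normsq x.
Proof.
by rewrite !normsqE mulr_sumr; apply: eq_bigr => i _; rewrite mxE exprMn.
Qed.

(** The reflection across the hyperplane orthogonal to [u - w]. When [u = w] the
    scalar [2 / normsq 0] is zero by convention and the formula degenerates to
    the identity, as wanted. *)
Lemma householder (R : realType) (n : nat) (u w : 'cV[R]_n) :
  normsq u = normsq w ->
  exists H : 'M[R]_n, [/\ H^T = H, H *m H = 1%:M & H *m u = w].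
Proof.
move=> uw; pose v := u - w; pose c := 2 / normsq v.
have vv : v^T *m v = (normsq v)%:M by rewrite [LHS]mx11_scalar.
have uvE : 2 * (v^T *m u) 0 0 = normsq v.
  have sym : (w^T *m u) 0 0 = (u^T *m w) 0 0.
    have <- : (w^T *m u)^T = u^T *m w by rewrite trmx_mul trmxK.
    by rewrite [RHS]mxE.
  have subE (M N : 'M[R]_1) : (M - N) 0 0 = M 0 0 - N 0 0 by rewrite !mxE.
  move: uw; rewrite /normsq /v linearB /= !mulmxBl !mulmxBr !subE sym => ->.
  ring.
exists (1%:M - c *: (v *m v^T)).
have [v0|v0] := eqVneq v 0.
  have -> : u = w by apply/eqP; rewrite -subr_eq0 -/v v0.
  by rewrite v0 mul0mx scaler0 subr0 trmx1 !mul1mx.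
have nv0 : normsq v != 0 by rewrite normsq_eq0.
split.
- by rewrite linearB /= trmx1 linearZ /= trmx_mul trmxK.
- rewrite mulmxBl mul1mx mulmxBr mulmx1 -scalemxAl -scalemxAr.
  rewrite mulmxA -(mulmxA v) vv mul_mx_scalar -scalemxAl !scalerA.
  have -> : c * (c * normsq v) = c + c by rewrite /c; field.
  by rewrite scalerDl opprB addrK subrK.
rewrite mulmxBl mul1mx -scalemxAl -mulmxA [v^T *m u]mx11_scalar mul_mx_scalar.
rewrite scalerA.
have -> : c * (v^T *m u) 0 0 = 1 by rewrite /c mulrAC uvE divff.
by rewrite scale1r /v subKr.
Qed.

(** * Real symmetric matrices *)

(** Over [R[i]] the matrix is Hermitian, so a unitary [P] diagonalizes it and
    its eigenvalues are real. Writing [z = P x] for a real [x] gives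
    [x^T B x = \sum_i d_i |z_i|^2] and [x^T x = \sum_i |z_i|^2], where the [d_i]
    are the eigenvalues, whence the Rayleigh bound. The maximizer must be a
    real vector: it is taken from the eigenspace of the real matrix [B] itself
    rather than from [P]. *)
Lemma symmetric_spectrum (R : realType) (n : nat) (B : 'M[R]_n.+1) :
  B^T = B ->
  exists s : n.+1.-tuple R,
   [/\ sorted_spectrum B s,
       forall x : 'cV[R]_n.+1, (x^T *m B *m x) 0 0 <= s`_0 * normsq x
     & exists2 x : 'cV[R]_n.+1, normsq x = 1 & B *m x = s`_0 *: x].
Proof.
move=> Bsym; set C := complexify B; set P := spectralmx C.
set sp := spectral_diag C.
have Cherm : C \is hermsymmx.
  apply/is_hermitianmxP; rewrite expr0 scale1r; apply/matrixP => i j.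
  by rewrite !mxE [LHS]/= -{1}Bsym mxE; exact: esym (conjc_real _).
have Cdec : C = invmx P *m diag_mx sp *m P.
  exact/orthomx_spectralP/hermitian_normalmx.
have [Pu Pinv] : P \in unitmx /\ invmx P = (P ^t* )%sesqui.
  split; first exact: spectral_unit.
  exact/invmx_unitary/spectral_unitarymx.
pose d := [tuple complex.Re (sp 0 i) | i < n.+1].
have spE i : sp 0 i = real_complex R (tnth d i).
  rewrite tnth_mktuple [RHS]RRe_real //.
  by have /mxOverP := hermitian_spectral_diag_real Cherm; apply.
pose s := sort_tuple (fun x y : R => y <= x) d.
have tot : total (fun x y : R => y <= x) by move=> x y; apply: le_total.
have s_sorted : sorted (fun x y : R => y <= x) s by apply: sort_sorted.
have s_spec : sorted_spectrum B s.
  split => //; rewrite -/C Cdec char_poly_conj //.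
  rewrite char_poly_trig ?diag_mx_is_trig //.
  have sd : perm_eq s d by rewrite perm_sort.
  rewrite (perm_big _ sd) big_tuple /=; apply: eq_bigr => i _.
  by rewrite mxE eqxx spE.
have d_le i : tnth d i <= s`_0.
  have : tnth d i \in s by rewrite mem_sort mem_tnth.
  rewrite memtE; move: (tval s) s_sorted => [|a t] /=; first done.
  move=> path_at; rewrite inE => /predU1P[->//|].
  have ge_trans : transitive (fun x y : R => y <= x).
    by move=> x y z yx xz; exact: le_trans xz yx.
  by move: (tnth d i); apply/allP; exact: order_path_min path_at.
exists s; split => //.
  move=> x; pose z := P *m map_mx (real_complex R) x.
  have conjr m (y : 'cV[R]_m) :
      (map_mx (real_complex R) y ^t* )%sesqui = map_mx (real_complex R) y^T.
    by apply/matrixP => i j; rewrite !mxE; exact: conjc_real.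
  have qE D : real_complex R ((x^T *m D *m x) 0 0) =
      (map_mx (real_complex R) x^T *m complexify D *m
       map_mx (real_complex R) x) 0 0.
    by rewrite -!map_mxM [RHS]mxE.
  have diagE e : ((z ^t* )%sesqui *m diag_mx e *m z) 0 0 =
      \sum_i e 0 i * `|z i 0| ^+ 2.
    rewrite mul_mx_diag mxE; apply: eq_bigr => i _.
    by rewrite !mxE normCKC mulrAC mulrC.
  have zadj : (z ^t* )%sesqui = map_mx (real_complex R) x^T *m invmx P.
    by rewrite Pinv /z trmx_mul map_mxM conjr.
  have B_diag : real_complex R ((x^T *m B *m x) 0 0) =
      \sum_i sp 0 i * `|z i 0| ^+ 2.
    by rewrite qE -/C {1}Cdec -diagE zadj /z !mulmxA.
  have n_diag : real_complex R (normsq x) = \sum_i `|z i 0| ^+ 2.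
    have := diagE (const_mx 1); rewrite diag_const_mx mulmx1 zadj /z.
    rewrite mulmxA mulmxKV // -map_mxM mxE => ->.
    by apply: eq_bigr => i _; rewrite mxE mul1r.
  rewrite -lecR rmorphM /= B_diag n_diag mulr_sumr; apply: ler_sum => i _.
  by rewrite ler_wpM2r ?exprn_ge0 // spE lecR.
have : eigenvalue B s`_0.
  have [cB _] := s_spec.
  rewrite -eigenvalue_complexify (split_eigenvalue _ cB) map_f //.
  by rewrite mem_nth // size_tuple.
case/eigenvalueP => v vB v0.
have v0' : v^T != 0 by rewrite -trmx0 (inj_eq trmx_inj).
(* Eigenvectors are row vectors on which B acts from the right; symmetry of B
   allows transposing. *)
exists ((Num.sqrt (normsq v^T))^-1 *: v^T).
  rewrite normsqZ exprVn sqr_sqrtr; last by rewrite ltW ?normsq_gt0.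
  by rewrite mulVf // normsq_eq0.
rewrite -scalemxAr scalerA [in RHS]mulrC -scalerA; congr (_ *: _).
by rewrite -{1}Bsym -trmx_mul vB linearZ.
Qed.

(** * Reversible matrices *)

(** [M] is [H S], where [S = diag (sqrt pi_i)] makes [A] symmetric and the
    reflection [H] sends the unit vector along [S 1] to the first basis vector.
    The first coordinate of [M x] is the inner product of [S 1 / |S 1|] and
    [S x], a nonzero multiple of [\sum_i pi_i x_i]. *)
Lemma reversible_reduction (R : realType) (m : nat) (A : 'M[R]_(1 + m))
    (pi : 'cV[R]_(1 + m)) :
  A *m (const_mx 1 : 'cV[R]_(1 + m)) = const_mx 1 ->
  (forall i, 0 < pi i 0) ->
  (forall i j, pi i 0 * A i j = pi j 0 * A j i) ->
  exists (M : 'M[R]_(1 + m)) (B : 'M[R]_m),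
   [/\ M \in unitmx, M^T *m M = diag_mx pi^T, B^T = B,
       A = invmx M *m block_mx (1%:M : 'M[R]_1) 0 0 B *m M
     & forall x : 'cV[R]_(1 + m),
         ((M *m x) 0 0 == 0) = (\sum_i pi i 0 * x i 0 == 0)].
Proof.
move=> A1 pi_gt0 pi_rev.
pose W := \sum_i pi i 0.
have W_gt0 : 0 < W.
  rewrite /W (bigD1 0) //= ltr_pwDl ?pi_gt0 // sumr_ge0 // => i _.
  exact/ltW/pi_gt0.
pose S := diag_mx (\row_i Num.sqrt (pi i 0)).
have SE p (y : 'M_(_, p)) i j : (S *m y) i j = Num.sqrt (pi i 0) * y i j.
  by rewrite mul_diag_mx !mxE.
have sq i : Num.sqrt (pi i 0) ^+ 2 = pi i 0 by rewrite sqr_sqrtr // ltW.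
have sq0 i : Num.sqrt (pi i 0) != 0 by rewrite gt_eqF ?sqrtr_gt0.
have Ssym : S^T = S by rewrite tr_diag_mx.
have SS : S *m S = diag_mx pi^T.
  by rewrite mulmx_diag; congr diag_mx; apply/rowP => i; rewrite !mxE -expr2.
have Su : S \in unitmx.
  rewrite unitmxE det_diag unitfE; apply/prodf_neq0 => i _; rewrite mxE.
  exact: sq0.
pose one : 'cV[R]_(1 + m) := const_mx 1.
pose w := Num.sqrt W.
have w0 : w != 0 by rewrite gt_eqF ?sqrtr_gt0.
pose u := w^-1 *: (S *m one).
pose e : 'cV[R]_(1 + m) := delta_mx 0 0.
have nu : normsq u = 1.
  rewrite normsqZ exprVn sqr_sqrtr ?ltW // normsqE -[X in X * _]/(W^-1).
  rewrite (eq_bigr (fun i => pi i 0)) ?mulVf ?gt_eqF // => i _.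
  by rewrite SE mxE mulr1 sq.
have ne : normsq e = 1.
  rewrite normsqE (bigD1 0) //= big1 => [|i i0]; rewrite mxE.
    by rewrite eqxx expr1n addr0.
  by rewrite (negPf i0) expr0n.
have [H [Hsym HH Hu]] : exists H : 'M[R]_(1 + m),
  [/\ H^T = H, H *m H = 1%:M & H *m u = e] by apply: householder; rewrite nu ne.
have Hunit : H \in unitmx by case/mulmx1_unit: HH.
pose M := H *m S.
have Mu : M \in unitmx by rewrite unitmx_mul Hunit.
have MM : M^T *m M = diag_mx pi^T.
  by rewrite trmx_mul Hsym Ssym -mulmxA (mulmxA H) HH mul1mx.
pose C := M *m A *m invmx M.
have Csym : C^T = C.
  (* Detailed balance says that diag pi *m A is symmetric, and C is congruent
     to that matrix. *)
  have DA : (M^T *m M *m A)^T = M^T *m M *m A.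
    rewrite MM; apply/matrixP => i j.
    by rewrite [LHS]mxE !mul_diag_mx !mxE pi_rev.
  have -> : C = (invmx M)^T *m (M^T *m M *m A) *m invmx M.
    by rewrite /C !mulmxA -trmx_mul mulmxV // trmx1 mul1mx.
  by rewrite 2!trmx_mul trmxK DA !mulmxA.
have Me : M *m (w^-1 *: one) = e by rewrite -scalemxAr -mulmxA scalemxAr.
have Ce : C *m e = e.
  have NMo : invmx M *m e = w^-1 *: one by rewrite -Me mulKmx.
  by rewrite /C -mulmxA NMo -mulmxA -scalemxAr A1.
(* The first column of C is thus e, and by symmetry so is its first row. *)
have C0 i : C i 0 = (i == 0)%:R.
  have := congr1 (fun y : 'cV_(1 + m) => y i 0) Ce.
  by rewrite -colE !mxE andbT.
exists M, (drsubmx C); split => //.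
- by rewrite trmx_drsub Csym.
- have -> : block_mx (1%:M : 'M[R]_1) 0 0 (drsubmx C) = C.
    have l0 : lshift m (0 : 'I_1) = 0 by apply: val_inj.
    move: (C) Csym C0 => D Dsym D0.
    rewrite -[RHS]submxK; congr block_mx; apply/matrixP => i j.
    + by rewrite !ord1 !mxE l0 D0.
    + by rewrite -Dsym !ord1 !mxE l0 D0.
    + by rewrite !ord1 !mxE l0 D0.
  by rewrite /C -mulmxA mulmxKV // mulKmx.
move=> x.
have -> : (M *m x) 0 0 = w^-1 * \sum_i pi i 0 * x i 0.
  have -> : (M *m x) 0 0 = (e^T *m (M *m x)) 0 0.
    by rewrite trmx_delta -rowE [RHS]mxE.
  rewrite -Hu trmx_mul Hsym -!mulmxA (mulmxA H) HH mul1mx linearZ /=.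
  rewrite -scalemxAl mxE; congr (_ * _).
  rewrite trmx_mul Ssym -mulmxA (mulmxA S) SS mxE.
  by apply: eq_bigr => i _; rewrite mul_diag_mx !mxE mul1r.
by rewrite mulf_eq0 invr_eq0 (negPf w0).
Qed.

(** Expanding [(x_i - x_j)^2]: the squares in [x_i] collapse because rows sum to
    one, those in [x_j] because [pi] is stationary. *)
Lemma dirichlet_sumE (R : realType) (n : nat) (A : 'M[R]_n) (pi x : 'cV[R]_n) :
  A *m (const_mx 1 : 'cV[R]_n) = const_mx 1 -> pi^T *m A = pi^T ->
  dirichlet_sum A pi x =
  2 * (\sum_i pi i 0 * x i 0 ^+ 2 - (x^T *m diag_mx pi^T *m A *m x) 0 0).
Proof.
move=> A1 piA.
have row_sum i : \sum_j A i j = 1.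
  have := congr1 (fun y : 'cV_n => y i 0) A1; rewrite !mxE => <-.
  by apply: eq_bigr => j _; rewrite mxE mulr1.
have col_sum j : \sum_i pi i 0 * A i j = pi j 0.
  have := congr1 (fun y : 'rV_n => y 0 j) piA; rewrite !mxE => <-.
  by apply: eq_bigr => i _; rewrite mxE.
have -> : (x^T *m diag_mx pi^T *m A *m x) 0 0 =
    \sum_i \sum_j pi i 0 * A i j * (x i 0 * x j 0).
  rewrite -mulmxA mxE; apply: eq_bigr => i _.
  rewrite mul_mx_diag !mxE mulr_sumr; apply: eq_bigr => j _; ring.
transitivity (\sum_i \sum_j pi i 0 * A i j * x i 0 ^+ 2
   + \sum_i \sum_j pi i 0 * A i j * x j 0 ^+ 2
   - 2 * \sum_i \sum_j pi i 0 * A i j * (x i 0 * x j 0)).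
  rewrite mulr_sumr -big_split -sumrB; apply: eq_bigr => i _.
  rewrite /= mulr_sumr -big_split -sumrB; apply: eq_bigr => j _ /=; ring.
rewrite mulrBr; congr (_ - _); rewrite mulr_natl mulr2n; congr (_ + _).
  apply: eq_bigr => i _; rewrite -mulr_suml -mulr_sumr row_sum; ring.
by rewrite exchange_big; apply: eq_bigr => j _; rewrite -mulr_suml col_sum.
Qed.

Theorem theorem4p1 (R : realType) (n : nat) (A : 'M[R]_n) (pi : 'cV[R]_n)
  (n_ge2 : (2 <= n)%N)
  (A_one : A *m (const_mx 1 : 'cV[R]_n) = const_mx 1)
  (A_spec : forall z : R[i], eigenvalue (complexify A) z -> `|z| <= 1)
  (pi_gt0 : forall i, 0 < pi i 0)
  (pi_stat : pi^T *m A = pi^T)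
  (pi_rev : forall i j, pi i 0 * A i j = pi j 0 * A j i) :
  (forall z : R[i], eigenvalue (complexify A) z ->
     exists r : R, z = real_complex R r) /\
  exists lambda : n.-tuple R,
    [/\ sorted_spectrum A lambda,
        lambda`_0 = 1,
        exists m : R,
          is_minimum [set dirichlet_sum A pi x | x in constraint_set pi] m /\
          lambda`_1 = 1 - 2^-1 * m
      & forall y : 'cV[R]_n, y != 0 -> \sum_i pi i 0 * y i 0 = 0 ->
          lambda`_1 >= 1 - dirichlet_sum A pi y /
                           (2 * \sum_i pi i 0 * y i 0 ^+ 2)].
Proof.
case: n n_ge2 A A_one A_spec pi pi_gt0 pi_stat pi_rev => [|[|m]] // _.
move=> A A_one A_spec pi pi_gt0 pi_stat pi_rev.
have [M [B [Mu MM Bsym AE M0]]] :=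
  @reversible_reduction R m.+1 A pi A_one pi_gt0 pi_rev.
have [s [Bs B_le [y0 y0_unit By0]]] := symmetric_spectrum Bsym.
have cA : char_poly (complexify A) =
    \prod_(l <- 1 :: val s) ('X - (real_complex R l)%:P).
  have [cB _] := Bs.
  rewrite -[complexify A]/(map_mx (real_complex R) A) -map_char_poly AE.
  rewrite char_poly_conj // (@char_poly_block_diag _ 1 m.+1) char_poly_mx11.
  rewrite rmorphM rmorphB /= map_polyX map_polyC map_char_poly big_cons.
  by rewrite -/(complexify B) cB.
pose N (x : 'cV[R]_m.+2) := \sum_i pi i 0 * x i 0 ^+ 2.
have NE x : normsq (M *m x) = N x.
  rewrite /normsq trmx_mul -mulmxA (mulmxA M^T) MM mxE.
  by apply: eq_bigr => i _; rewrite mul_diag_mx !mxE mulrCA expr2.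
have quadE x y : M *m x = col_mx (0 : 'cV[R]_1) y ->
    N x = normsq y /\
    dirichlet_sum A pi x = 2 * (normsq y - (y^T *m B *m y) 0 0).
  move=> Mx.
  have nx : N x = normsq y.
    by rewrite -NE Mx /normsq tr_col_mx mul_row_col trmx0 mul0mx add0r.
  split; first exact: nx.
  rewrite dirichlet_sumE // -/(N x) nx -MM; congr (_ * (_ - _)).
  have -> : x^T *m (M^T *m M) *m A *m x =
      (M *m x)^T *m (block_mx (1%:M : 'M[R]_1) 0 0 B *m (M *m x)).
    by rewrite {1}AE trmx_mul -!mulmxA mulKVmx.
  rewrite Mx mul_block_col !mulmx0 mul0mx !add0r tr_col_mx mul_row_col.
  by rewrite mulmx0 add0r mulmxA.
have centred (x : 'cV[R]_m.+2) : \sum_i pi i 0 * x i 0 = 0 -> exists y,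
    M *m x = col_mx (0 : 'cV[R]_1) y.
  move=> /eqP; rewrite -M0 => /eqP Mx0.
  exists (dsubmx (M *m x : 'cV_(1 + m.+1))).
  rewrite -[LHS](@vsubmxK _ 1 m.+1); congr col_mx.
  apply/colP => i; rewrite ord1 [LHS]mxE [RHS]mxE -[RHS]Mx0; congr (_ _ _).
  exact: val_inj.
(* The spectral gap inequality; all remaining estimates are instances of it. *)
have gap (x : 'cV[R]_m.+2) : \sum_i pi i 0 * x i 0 = 0 ->
    2 * (1 - s`_0) * N x <= dirichlet_sum A pi x.
  move=> /centred[y Mx]; have [-> ->] := quadE x y Mx.
  by rewrite -mulrA ler_pM2l // mulrBl mul1r lerD2l lerN2.
split.
  by move=> z; rewrite (split_eigenvalue _ cA) => /mapP[r _ ->]; exists r.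
(* The bound on the moduli is what puts 1 first in the decreasing order. *)
have s_le1 r : r \in val s -> r <= 1.
  move=> rs; have /A_spec : eigenvalue (complexify A) (real_complex R r).
    by rewrite (split_eigenvalue _ cA) map_f // inE rs orbT.
  move/(le_trans (real_ler_norm _)); rewrite -lecR; apply.
  by apply/complex_realP; exists r.
exists [tuple of 1 :: s]; split => //.
- split => //; case: Bs => _.
  case: (s) s_le1 => -[|a t] //= _ s_le1 a_t.
  by rewrite a_t andbT s_le1 // inE eqxx.
- exists (2 * (1 - s`_0)); split; last by rewrite mulKf ?pnatr_eq0 // subKr.
  split.
    (* The minimum is attained at the preimage of the top eigenvector of B. *)
    pose x0 := invmx M *m (col_mx (0 : 'cV[R]_1) y0 : 'cV_(1 + m.+1)).
    have Mx0 : M *m x0 = col_mx (0 : 'cV[R]_1) y0 by rewrite mulKVmx.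
    have [Nx0 Dx0] := quadE x0 y0 Mx0.
    exists x0.
      split; last by rewrite -/(N x0) Nx0.
      apply/eqP; rewrite -M0 Mx0; apply/eqP.
      have -> : (0 : 'I_(1 + m.+1)) = lshift m.+1 0 by apply: val_inj.
      by rewrite col_mxEu mxE.
    rewrite Dx0 -mulmxA By0 -scalemxAr [X in _ - X]mxE -/(normsq y0).
    by rewrite y0_unit mulr1.
  move=> _ [x [x_pi Nx] <-].
  by have := gap x x_pi; rewrite /N Nx mulr1.
move=> y y_neq0 y_pi; have := gap y y_pi; rewrite -/(N y).
have Ny : 0 < N y.
  rewrite -NE normsq_gt0; apply: contra_neq y_neq0 => My.
  by rewrite -(mulKmx Mu y) My mulmx0.
rewrite [s`_0]/= => h; rewrite lerBlDl -lerBlDr ler_pdivlMr ?mulr_gt0 //.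
by rewrite mulrCA mulrA.
Qed.
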